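(* Let $\mathbb{F}$ be a field with involution $\overline{\,\cdot\,}$, let $m,n\ge 1$, let $x,y\in\mathbb{F}^m$ and $z,w\in\mathbb{F}^n$ be column vectors with all entries nonzero, let $a,b\in\mathbb{F}\setminus\{0\}$, and let $$M=\left[\begin{array}{cc|cc}0&x^T&a&0\\ y&0&0&0\\ \hline b&0&0&z^T\\ 0&0&w&0\end{array}\right]$$ (a square matrix of order $m+n+2$). Assume $x^Ty=z^Tw=0$ and that $M$ is Moore–Penrose invertible and core EP invertible (equivalently, the scalars $s=x^*x$, $u=y^*y$, $t=z^*z$, $v=w^*w$, $r=a\overline{a}+w^*w$, $h=b\overline{b}+y^*y$ are all nonzero). Then the GDC inverse of $M$ is $$M^{\mathrm{GDC}}=\left[\begin{array}{cc|cc}0&\overline{a}(br)^{-1}x^T&b^{-1}&0\\ 0&0&0&0\\ \hline a^{-1}&0&0&\overline{b}(ah)^{-1}z^T\\ 0&0&0&0\end{array}\right].$$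
   Context: For a matrix $A=[a_{ij}]$ over a field $\mathbb{F}$ with involution $\overline{\,\cdot\,}$ (a field automorphism with $\overline{\overline{c}}=c$), $\overline{A}=[\overline{a_{ij}}]$ and $A^*=\overline{A}^{\,T}$. All $4\times4$ block matrices have rows and columns partitioned with sizes $1,m,1,n$; each $0$ is a zero block of the appropriate size. Matrices $M$ of the displayed form are the matrices whose associated digraph is a double star digraph, in canonical form. The Moore–Penrose inverse $A^\dagger$ is the unique $X$ (if it exists) with $AXA=A$, $XAX=X$, $(AX)^*=AX$, $(XA)^*=XA$. A square matrix $A$ is core EP invertible if there is $X$ with $XA^{k+1}=A^k$ for some nonnegative integer $k$, $AX^2=X$, $(AX)^*=AX$; such $X$ is unique, called the core EP inverse and denoted $A^{\mathrm{cEP}}$. When $A^\dagger$ and $A^{\mathrm{cEP}}$ exist, the generalized dual core (GDC) inverse $A^{\mathrm{GDC}}$ is the unique $X$ with $XAX=X$, $AX=A^{\mathrm{cEP}}A$, $XA=A^\dagger A^{\mathrm{cEP}}A^2$; explicitly $A^{\mathrm{GDC}}=A^\dagger A^{\mathrm{cEP}}A$. *)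

(* Defs.v *)
From mathcomp Require Import all_boot all_order all_algebra.
From mathcomp Require Export sesquilinear.

Set Implicit Arguments.
Unset Strict Implicit.
Unset Printing Implicit Defensive.

Import GRing.Theory.
Local Open Scope ring_scope.
Local Open Scope sesquilinear_scope.

(* The involution of F is [conj : involutive_rmorphism F], and the conjugate
   transpose A^* is the library's [A ^t conj]. *)

Definition is_MP (F : fieldType) (conj : involutive_rmorphism F) (p q : nat)
    (A : 'M[F]_(p, q)) (X : 'M[F]_(q, p)) : Prop :=
  [/\ A *m X *m A = A, X *m A *m X = X,
      (A *m X) ^t conj = A *m X & (X *m A) ^t conj = X *m A].

Definition is_cEP (F : fieldType) (conj : involutive_rmorphism F) (p : nat)
    (A X : 'M[F]_p) : Prop :=
  [/\ exists k : nat, X *m A ^+ k.+1 = A ^+ k,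
      A *m X ^+ 2 = X & (A *m X) ^t conj = A *m X].

Definition MP_invertible (F : fieldType) (conj : involutive_rmorphism F)
    (p q : nat) (A : 'M[F]_(p, q)) : Prop :=
  exists X, is_MP conj A X.

Definition cEP_invertible (F : fieldType) (conj : involutive_rmorphism F)
    (p : nat) (A : 'M[F]_p) : Prop :=
  exists X, is_cEP conj A X.

(* [P] and [C] are unique ([is_MP_uniq], [is_cEP_uniq]); [is_GDC_prod] shows that
   the GDC inverse exists as soon as they do, is unique, and equals [P *m C *m A]. *)
Definition is_GDC (F : fieldType) (conj : involutive_rmorphism F) (p : nat)
    (A X : 'M[F]_p) : Prop :=
  exists P C : 'M[F]_p,
    [/\ is_MP conj A P, is_cEP conj A C &
        [/\ X *m A *m X = X, A *m X = C *m A & X *m A = P *m C *m A ^+ 2]].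

Definition double_star_mx (F : fieldType) (m n : nat) (x y : 'cV[F]_m)
    (z w : 'cV[F]_n) (a b : F) : 'M[F]_((1 + m) + (1 + n)) :=
  block_mx (block_mx 0   x^T
                     y   0  )  (block_mx a%:M 0
                                         0    0)
           (block_mx b%:M 0
                     0    0 )  (block_mx 0    z^T
                                         w    0).

Definition double_star_GDC (F : fieldType) (conj : involutive_rmorphism F)
    (m n : nat) (x : 'cV[F]_m) (z : 'cV[F]_n) (a b r h : F) :
    'M[F]_((1 + m) + (1 + n)) :=
  block_mx (block_mx 0 ((conj a * (b * r)^-1) *: x^T)
                     0 0)  (block_mx (b^-1)%:M 0
                                     0         0)
           (block_mx (a^-1)%:M 0
                     0         0)  (block_mx 0 ((conj b * (a * h)^-1) *: z^T)
                                             0 0).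

Lemma is_MP_uniq (F : fieldType) (conj : involutive_rmorphism F) (p q : nat)
    (A : 'M[F]_(p, q)) (X Y : 'M[F]_(q, p)) :
  is_MP conj A X -> is_MP conj A Y -> X = Y.
Proof.
move=> [AXA XAX hAX hXA] [AYA YAY hAY hYA].
have starM k l r (U : 'M[F]_(k, l)) (V : 'M[F]_(l, r)) :
    (U *m V) ^t conj = V ^t conj *m U ^t conj by rewrite trmx_mul map_mxM.
have eA : A *m X = A *m Y.
  rewrite -hAX -{1}AYA -(mulmxA (A *m Y)) starM hAX hAY.
  by rewrite mulmxA AXA.
have eB : X *m A = Y *m A.
  rewrite -hXA -{1}AYA -(mulmxA A) mulmxA starM hXA hYA.
  by rewrite -mulmxA (mulmxA A) AXA.
by rewrite -XAX eB -mulmxA eA mulmxA YAY.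
Qed.

Section CoreEP.
Variables (F : fieldType) (conj : involutive_rmorphism F) (p : nat).
Implicit Types A X Y P C : 'M[F]_p.

Lemma is_cEP_iter A X j : A *m X ^+ 2 = X -> A ^+ j *m X ^+ j.+1 = X.
Proof.
move=> h; elim: j => [|j IH]; first by rewrite expr0 mul1mx expr1.
rewrite exprSr !exprS !mulmxE !mulrA -(mulrA _ A) -(mulrA _ (A * X)).
rewrite -[RHS]IH !exprS !mulmxE -!mulrA; congr (_ * _).
by rewrite !mulrA -(mulrA A); move: h; rewrite expr2 mulmxE => ->.
Qed.

Lemma is_cEP_outer A X : is_cEP conj A X -> X *m A *m X = X.
Proof.
case=> -[k hk] h _; rewrite -{2}(is_cEP_iter k h) -mulmxA (mulmxA A).
by rewrite !mulmxE -exprS -mulmxE mulmxA hk is_cEP_iter.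
Qed.

Lemma is_cEP_rangeM A X Y :
  is_cEP conj A X -> is_cEP conj A Y ->
  A *m Y *m X = X /\ A *m Y *m (A *m X) = A *m X.
Proof.
move=> [_ hX _] [[k hk] hY _].
have fixk : A *m Y *m A ^+ k = A ^+ k.
  rewrite -[in LHS]hk -(mulmxA A) (mulmxA Y Y).
  by move: hY; rewrite expr2 -mulmxE mulmxA => hY; rewrite !mulmxA hY hk.
have fixX : A *m Y *m X = X.
  by rewrite -{1}(is_cEP_iter k hX) mulmxA fixk is_cEP_iter.
split=> //; rewrite -(is_cEP_iter k hX) (mulmxA A (A ^+ k)).
have AS : A *m A ^+ k = A ^+ k *m A by rewrite mulmxE -exprS exprSr.
by rewrite AS -(mulmxA (A ^+ k)) mulmxA fixk.
Qed.

Lemma is_cEP_uniq A X Y : is_cEP conj A X -> is_cEP conj A Y -> X = Y.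
Proof.
move=> cX cY.
have [[k hk] hX tX] := cX; have [_ hY tY] := cY.
have [_ eX] := is_cEP_rangeM cX cY; have [_ eY] := is_cEP_rangeM cY cX.
have eA : A *m X = A *m Y.
  by rewrite -eX -[in LHS]tX -[in LHS]tY -map_mxM -trmx_mul eY tY.
have kill U : A *m U ^+ 2 = U -> X *m (A *m U) = U.
  move=> hU; rewrite -[in LHS](is_cEP_iter k hU) (mulmxA A (A ^+ k)).
  have -> : A *m A ^+ k = A ^+ k.+1 by rewrite exprS.
  by rewrite mulmxA hk is_cEP_iter.
by rewrite -(kill X hX) eA kill.
Qed.

Lemma is_GDC_prod A P C X :
  is_MP conj A P -> is_cEP conj A C ->
  is_GDC conj A X <-> X = P *m C *m A.
Proof.
move=> mP cC; have [mpA _ _ _] := mP; have [_ hC _] := cC.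
have APC : A *m P *m C = C.
  by rewrite -{1}hC expr2 -mulmxE !mulmxA mpA -mulmxA mulmxE -expr2.
have CAC := is_cEP_outer cC.
split=> [[P' [C' [mP' cC' [h1 h2 h3]]]] | ->].
  rewrite -(is_MP_uniq mP mP') -(is_cEP_uniq cC cC') in h2 h3.
  rewrite -h1 h3 expr2 -mulmxE -!mulmxA h2 !mulmxA.
  by rewrite -2!(mulmxA P) CAC mulmxA.
exists P, C; split=> //; split.
- rewrite !mulmxA -(mulmxA _ A P) -(mulmxA _ (A *m P)) APC.
  by rewrite -2!(mulmxA P) CAC mulmxA.
- by rewrite !mulmxA APC.
- by rewrite expr2 -mulmxE !mulmxA.
Qed.

End CoreEP.

(* Main.v *)
Require Import Defs.
From mathcomp Require Import all_boot all_order all_algebra.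

Set Implicit Arguments.
Unset Strict Implicit.
Unset Printing Implicit Defensive.

Import GRing.Theory.
Local Open Scope ring_scope.
Local Open Scope sesquilinear_scope.

(** Write [A^H] for the conjugate transpose [A ^t conj].  Over a field with
    involution the form [v^H v] may be isotropic, so the orthogonal projector onto
    the column space of a matrix [U] of full column rank exists exactly when the
    Gram matrix [U^H U] is invertible; it is then [U (U^H U)^-1 U^H].  Both
    generalized inverses are governed by this fact ([hermitian_proj_gram_unit]).

    If [A P A = A] with [A P] and [P A] hermitian, these two products are the
    orthogonal projectors onto the column space and onto the adjoint of the row
    space of [A].  Hence a full rank factorization [A = B K D], with [K]
    invertible, is Moore-Penrose invertible iff [B^H B] and [D D^H] are invertible
    ([MP_invertible_factor]).

    If the columns of [U] are a basis of the column space of [A ^+ j], and [A] acts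
    on them through an invertible matrix [T] ([A U = U T]), then a core EP inverse
    [C] makes [A C] the orthogonal projector onto that space.  So [C] exists iff
    [U^H U] is invertible ([cEP_invertible_core]), and it projects onto the space
    and then undoes [A] there: [C = U T^-1 (U^H U)^-1 U^H] ([cEP_core]).  If
    moreover [U = A V] with [V] in the adjoint of the row space of [A], then
    [P U = P A V = V], so the generalized dual core inverse [P C A] is
    [V T^-1 (U^H U)^-1 U^H A], an expression free of [P] ([GDC_core]).

    For the double star matrix [M], write [e1], [e3] for the two centres and [y],
    [w] for the vectors [y], [w] placed in the second and fourth block.  The column
    space of [M] has the orthogonal basis [e1, y, e3, w] and its row space the basis
    [e1^T, x^T, e3^T, z^T], so the Moore-Penrose condition is [u, v, s, t != 0].
    Since [x^T y = z^T w = 0], the column space of [M ^+ 2] is spanned by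
    [M e3 = a e1 + w] and [M e1 = y + b e3], which [M] exchanges up to the scalars
    [a] and [b].  These two vectors are orthogonal with squares [r] and [h], so the
    core EP condition is [r, h != 0].  The vectors [e1] and [e3] lie in the adjoint
    of the row space, and [GDC_core] with [V = (e3, e1)] gives the formula. *)

(** * Moore-Penrose and core EP inverses from Gram matrices *)

Section Star.
Variables (F : fieldType) (conj : involutive_rmorphism F).

Lemma starM p q r (A : 'M[F]_(p, q)) (B : 'M[F]_(q, r)) :
  (A *m B) ^t conj = B ^t conj *m A ^t conj.
Proof. by rewrite trmx_mul map_mxM. Qed.

Lemma starK p q (A : 'M[F]_(p, q)) : (A ^t conj) ^t conj = A.
Proof. by apply/matrixP=> i j; rewrite !mxE rmorphK. Qed.

Lemma star1 p : (1%:M : 'M[F]_p) ^t conj = 1%:M.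
Proof. by rewrite trmx1 map_mx1. Qed.

Lemma star_gram p q (U : 'M[F]_(p, q)) :
  (U ^t conj *m U) ^t conj = U ^t conj *m U.
Proof. by rewrite starM starK. Qed.

Lemma star_inv p (A : 'M[F]_p) : (invmx A) ^t conj = invmx (A ^t conj).
Proof. by rewrite trmx_inv map_invmx. Qed.

Lemma star_gram_inv p q (U : 'M[F]_(p, q)) :
  (invmx (U ^t conj *m U)) ^t conj = invmx (U ^t conj *m U).
Proof. by rewrite star_inv star_gram. Qed.

(** [E] is an orthogonal projector onto the column space of [U].  For a left
    inverse [L] of [U], [U^H U (G L^H) = U^H E L^H = (E U)^H L^H = (L U)^H = 1]. *)
Lemma hermitian_proj_gram_unit p k (E : 'M[F]_p) (U : 'M[F]_(p, k)) G :
  E ^t conj = E -> E *m U = U -> E = U *m G -> row_free U^T ->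
  U ^t conj *m U \in unitmx.
Proof.
move=> hE EU eE /row_freeP[L hL].
have {}hL : L^T *m U = 1%:M by rewrite -[U]trmxK -trmx_mul hL trmx1.
have e : U ^t conj *m U *m (G *m L^T ^t conj) = 1%:M.
  by rewrite mulmxA -(mulmxA _ U) -eE -{1}hE -starM EU -starM hL star1.
by case/mulmx1_unit: e.
Qed.

Lemma MP_star p q (A : 'M[F]_(p, q)) :
  MP_invertible conj A -> MP_invertible conj (A ^t conj).
Proof.
case=> X [h1 h2 h3 h4]; exists (X ^t conj).
by split; rewrite -?starM ?h3 ?h4 ?starK // mulmxA ?h1 ?h2.
Qed.

(** The projector is [A P], where [P] is the Moore-Penrose inverse; a right inverse
    of [D] shows that the columns of [B] belong to its range. *)
Lemma MP_gram_unit p q k (A : 'M[F]_(p, q)) (B : 'M_(p, k)) (D : 'M_(k, q)) :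
  A = B *m D -> row_free D -> row_free B^T ->
  MP_invertible conj A -> B ^t conj *m B \in unitmx.
Proof.
move=> eA /row_freeP[R hR] fB [X [AXA _ hAX _]].
apply: (@hermitian_proj_gram_unit _ _ (A *m X) _ (D *m X)) => //.
  have -> : B = A *m R by rewrite eA -mulmxA hR mulmx1.
  by rewrite !mulmxA AXA.
by rewrite eA mulmxA.
Qed.

(** The inverse is [D^H (D D^H)^-1 K^-1 (B^H B)^-1 B^H].  Keeping the invertible
    factor [K] apart leaves [B] and [D] free to be bases with simple Gram matrices.
    For the necessity on the row side, [MP_gram_unit] applies to [A^H]. *)
Theorem MP_invertible_factor p q k (A : 'M[F]_(p, q)) (B : 'M_(p, k))
    (K : 'M_k) (D : 'M_(k, q)) :
  A = B *m K *m D -> row_free B^T -> K \in unitmx -> row_free D ->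
  MP_invertible conj A <->
  B ^t conj *m B \in unitmx /\ D *m D ^t conj \in unitmx.
Proof.
move=> eA fB uK fD; split=> [mA | [uB uD]].
  split.
    apply: (MP_gram_unit (D := K *m D)) mA => //; first by rewrite eA mulmxA.
    by rewrite /row_free mxrankMfree // mxrank_unit.
  have := MP_gram_unit _ _ _ (MP_star mA).
  move/(_ _ (D ^t conj) (K ^t conj *m B ^t conj)); rewrite starK; apply.
  - by rewrite eA !starM.
  - rewrite -starM /row_free mxrank_map mxrank_tr -mxrank_tr trmx_mul.
    by rewrite mxrankMfree // mxrank_unit ?unitmx_tr.
  - by rewrite map_trmx trmxK /row_free mxrank_map.
have DD : D *m D ^t conj = (D ^t conj) ^t conj *m D ^t conj by rewrite starK.
set G := invmx (B ^t conj *m B); set H := invmx (D *m D ^t conj).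
pose X := D ^t conj *m H *m invmx K *m G *m B ^t conj.
have AX : A *m X = B *m G *m B ^t conj.
  rewrite /X eA !mulmxA -(mulmxA _ D) -(mulmxA _ (D *m _)) mulmxV // mulmx1.
  by rewrite -(mulmxA B) mulmxV // mulmx1.
have XA : X *m A = D ^t conj *m H *m D.
  rewrite /X eA !mulmxA -(mulmxA _ (B ^t conj) B) -(mulmxA _ G) mulVmx // mulmx1.
  by rewrite -(mulmxA _ (invmx K) K) mulVmx // mulmx1.
exists X; split.
- rewrite AX eA !mulmxA -(mulmxA _ (B ^t conj) B) -(mulmxA B G) mulVmx //.
  by rewrite mulmx1.
- rewrite XA /X !mulmxA -(mulmxA _ D) -(mulmxA _ H (D *m _)).
  by rewrite mulVmx // mulmx1.
- by rewrite AX !starM starK star_gram_inv mulmxA.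
- by rewrite XA !starM starK /H DD star_gram_inv mulmxA.
Qed.

Section CoreEP.
Variables (p k : nat) (A : 'M[F]_p) (U : 'M[F]_(p, k)) (T : 'M[F]_k).
Hypotheses (AU : A *m U = U *m T) (uT : T \in unitmx).

(** In particular the columns of [U] lie in the column space of every power of [A],
    including the unknown power in the definition of a core EP inverse. *)
Lemma expmx_invariant j : exists2 S : 'M_k, S \in unitmx & A ^+ j *m U = U *m S.
Proof.
elim: j => [|j [S uS e]]; first by exists 1%:M; rewrite ?unitmx1 // mul1mx mulmx1.
exists (T *m S); first by rewrite unitmx_mul uT.
by rewrite exprS -mulmxE -mulmxA e !mulmxA AU.
Qed.

(** The orthogonal projection onto the column space of [U] followed by the inverse
    of [A] on that space. *)
Lemma cEP_core j (G : 'M[F]_(k, p)) :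
  A ^+ j = U *m G -> U ^t conj *m U \in unitmx ->
  is_cEP conj A (U *m invmx T *m invmx (U ^t conj *m U) *m U ^t conj).
Proof.
move=> eAj uU; set H := invmx (U ^t conj *m U); set C := U *m _ *m _ *m _.
have CU : C *m U = U *m invmx T.
  by rewrite /C -(mulmxA _ _ U) -(mulmxA _ H (_ *m U)) mulVmx // mulmx1.
have AC : A *m C = U *m H *m U ^t conj.
  by rewrite /C !mulmxA AU -(mulmxA U) mulmxV // mulmx1.
split.
- exists j; rewrite exprS eAj -mulmxE (mulmxA A) AU !mulmxA CU.
  by rewrite -(mulmxA U) mulVmx // mulmx1.
- rewrite expr2 -mulmxE mulmxA AC {1}/C !mulmxA -(mulmxA _ (U ^t conj)).
  by rewrite -(mulmxA U) mulVmx // mulmx1.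
- by rewrite AC !starM starK star_gram_inv mulmxA.
Qed.

(** For the necessity, [A C] is the orthogonal projector: it fixes the column space
    of [A ^+ i] for the index [i] of [C], and its range lies in the column space of
    [A ^+ j] because [C = A ^+ j C ^+ j.+1]. *)
Theorem cEP_invertible_core j (G : 'M[F]_(k, p)) :
  A ^+ j = U *m G -> row_free U^T ->
  cEP_invertible conj A <-> U ^t conj *m U \in unitmx.
Proof.
move=> eAj fU; split=> [[C [[i hi] hC hAC]] | uU]; last first.
  by eexists; apply: cEP_core uU; apply: eAj.
have eAC : A *m C = U *m (G *m (A *m C ^+ j.+1)); last first.
  apply: hermitian_proj_gram_unit eAC _ => //.
  have [S uS eS] := expmx_invariant i.
  have -> : U = A ^+ i *m (U *m invmx S).
    by rewrite mulmxA eS -mulmxA mulmxV // mulmx1.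
  rewrite mulmxA -{1}hi exprS -mulmxE !mulmxA; congr (_ *m _ *m _).
  rewrite -[in RHS]hi exprS -mulmxE !mulmxA; do 2 congr (_ *m _).
  by rewrite -[RHS]hC expr2 -mulmxE mulmxA.
rewrite mulmxA -eAj mulmxA -{1}(is_cEP_iter j hC) !mulmxA.
by rewrite !mulmxE -exprS -exprSr.
Qed.

(** The Moore-Penrose inverse [P] enters only through [P U = P A V = V]: [P A] is
    the orthogonal projector onto the adjoint of the row space, which contains [V]. *)
Theorem GDC_core j (G : 'M[F]_(k, p)) (V : 'M[F]_(p, k)) :
  A ^+ j = U *m G -> U ^t conj *m U \in unitmx ->
  A *m V = U -> (V ^t conj <= A)%MS -> MP_invertible conj A ->
  unique (is_GDC conj A)
    (V *m invmx T *m invmx (U ^t conj *m U) *m (U ^t conj *m A)).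
Proof.
move=> eAj uU AV /submxP[S hS] [P mP]; have cC := cEP_core eAj uU.
have PU : P *m U = V.
  case: mP => APA _ _ hPA.
  by rewrite -AV mulmxA -[V]starK hS -{1}hPA -starM -mulmxA (mulmxA A) APA.
split=> [|X]; first by apply/(is_GDC_prod _ mP cC); rewrite !mulmxA PU.
by move/(is_GDC_prod _ mP cC) => ->; rewrite !mulmxA PU.
Qed.

End CoreEP.
End Star.

(** * Block computations *)

(** A column block times a row block is a redex of both [mul_col_row] and
    [mul_col_mx]; the former comes first, so that all four blocks appear. *)
Definition blockE := (mul_col_row, mulmx_block, mul_block_col, mul_row_block,
  mul_row_col, mul_col_mx, add_block_mx, add_row_mx, add_col_mx).

Definition zeroE := (mul0mx, mulmx0, col_mx0, row_mx0, add0r, addr0).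

Lemma invmx_eq (F : fieldType) k (A B : 'M[F]_k) : A *m B = 1%:M -> invmx A = B.
Proof.
by move=> AB; have [uA _] := mulmx1_unit AB; rewrite -[B](mulKmx uA) AB mulmx1.
Qed.

Lemma rank_cV (F : fieldType) k (v : 'cV[F]_k) : \rank v = (v != 0).
Proof. by rewrite -mxrank_tr rank_rV trmx_eq0. Qed.

(** * The double star matrix *)

Section DoubleStar.
Variables (F : fieldType) (conj : involutive_rmorphism F) (m n : nat).
Variables (x y : 'cV[F]_m) (z w : 'cV[F]_n) (a b : F).

Local Notation M := (double_star_mx x y z w a b).

Definition column_basis : 'M[F]_((1 + m) + (1 + n), (1 + 1) + (1 + 1)) :=
  block_mx (block_mx 1%:M 0 0 y) 0 0 (block_mx 1%:M 0 0 w).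

Definition row_basis : 'M[F]_((1 + 1) + (1 + 1), (1 + m) + (1 + n)) :=
  block_mx (block_mx 1%:M 0 0 x^T) 0 0 (block_mx 1%:M 0 0 z^T).

(** The matrix [M] in [column_basis] and [row_basis] is again a double star, with
    one leaf on each side. *)
Definition star_core : 'M[F]_((1 + 1) + (1 + 1)) :=
  double_star_mx 1%:M 1%:M 1%:M 1%:M a b.

Lemma double_star_factor : M = column_basis *m star_core *m row_basis.
Proof.
rewrite /column_basis /star_core /row_basis /double_star_mx !blockE !zeroE.
rewrite !(trmx1, mul1mx, mulmx1).
by rewrite !(blockE, zeroE, mul1mx, mulmx1).
Qed.

Lemma star_core_unit : star_core \in unitmx.
Proof.
pose L : 'M[F]_((1 + 1) + (1 + 1)) :=
  block_mx (block_mx 0 1%:M 1%:M 0) (block_mx 0 0 0 (- a)%:M)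
           (block_mx 0 0 0 (- b)%:M) (block_mx 0 1%:M 1%:M 0).
suff /mulmx1_unit[] : star_core *m L = 1%:M by [].
rewrite /star_core /L /double_star_mx !blockE !zeroE !(trmx1, mul1mx, mulmx1).
by rewrite !raddfN /= !addrN !addNr -!scalar_mx_block block_mx0 -scalar_mx_block.
Qed.

Lemma unitmx11 (A : 'M[F]_1) : (A \in unitmx) = (A 0 0 != 0).
Proof. by rewrite unitmxE [A]mx11_scalar det_scalar1 unitfE !mxE. Qed.

Lemma gram_trmx k (v : 'cV[F]_k) : v^T *m v^T ^t conj = ((v ^t conj *m v)^T).
Proof. by rewrite trmx_mul map_trmx !trmxK. Qed.

Lemma double_star_MP : x != 0 -> y != 0 -> z != 0 -> w != 0 ->
  MP_invertible conj M <->
  ((y ^t conj *m y) 0 0 != 0 /\ (w ^t conj *m w) 0 0 != 0) /\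
  ((x ^t conj *m x) 0 0 != 0 /\ (z ^t conj *m z) 0 0 != 0).
Proof.
move=> x0 y0 z0 w0.
apply: (iff_trans (MP_invertible_factor conj double_star_factor _ star_core_unit _)).
- rewrite /row_free mxrank_tr /column_basis !rank_diag_block_mx !mxrank1.
  by rewrite !rank_cV y0 w0.
- rewrite /row_free /row_basis !rank_diag_block_mx !mxrank1 !mxrank_tr.
  by rewrite !rank_cV x0 z0.
rewrite /column_basis /row_basis !tr_block_mx !map_block_mx !trmx0 !map_mx0.
rewrite !blockE !zeroE.
rewrite !star1 !mul1mx !block_diag_mx_unit !unitmx1 /= !unitmx11.
rewrite !gram_trmx ![(_ ^T) 0 0]mxE.
by split=> [[/andP[-> ->] /andP[-> ->]] | [[-> ->] [-> ->]]].
Qed.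

(** The images [M e3 = a e1 + w] and [M e1 = y + b e3] of the centres, a basis of
    the column space of [M ^+ 2]. *)
Definition core_basis : 'M[F]_((1 + m) + (1 + n), 1 + 1) :=
  col_mx (block_mx a%:M 0 0 y) (block_mx 0 b%:M w 0).

(** The vectors [e3] and [e1], in the order that matches [core_basis]. *)
Definition centres : 'M[F]_((1 + m) + (1 + n), 1 + 1) :=
  col_mx (block_mx 0 1%:M 0 0) (block_mx 1%:M 0 0 0).

Definition core_action : 'M[F]_(1 + 1) := block_mx 0 b%:M a%:M 0.

Definition core_coord : 'M[F]_(1 + 1, (1 + m) + (1 + n)) :=
  row_mx (block_mx b%:M 0 0 x^T) (block_mx 0 z^T a%:M 0).

Local Notation U := core_basis.
Local Notation V := centres.
Local Notation T := core_action.
Local Notation r := (a * conj a + (w ^t conj *m w) 0 0).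
Local Notation h := (b * conj b + (y ^t conj *m y) 0 0).

Lemma mul_star_centres : M *m V = U.
Proof.
by rewrite /centres /core_basis /double_star_mx !blockE !zeroE !mulmx1.
Qed.

Hypotheses (hxy : x^T *m y = 0) (hzw : z^T *m w = 0).

Lemma mul_star_core_basis : M *m U = U *m T.
Proof.
rewrite /core_action /core_basis /double_star_mx !blockE hxy hzw !zeroE.
by rewrite !mul_scalar_mx !mul_mx_scalar !scale_scalar_mx mulrC.
Qed.

(** This is where the orthogonality relations cut the rank of [M ^+ 2] to two. *)
Lemma double_star_sqr : M ^+ 2 = U *m core_coord.
Proof.
rewrite expr2 -mulmxE /core_basis /core_coord /double_star_mx !blockE hxy hzw !zeroE.
by rewrite !mul_scalar_mx !mul_mx_scalar !scale_scalar_mx mulrC.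
Qed.

Lemma core_gram : U ^t conj *m U = block_mx r%:M 0 0 h%:M.
Proof.
rewrite /core_basis tr_col_mx map_row_mx !tr_block_mx !map_block_mx !trmx0 !map_mx0.
rewrite !blockE !zeroE !tr_scalar_mx !map_scalar_mx /= !mul_scalar_mx.
rewrite !scale_scalar_mx [in LHS](mx11_scalar (w ^t conj *m w)).
rewrite [in LHS](mx11_scalar (y ^t conj *m y)).
rewrite -!raddfD /= [_ + conj b * b]addrC.
by rewrite (mulrC (conj a)) (mulrC (conj b)).
Qed.

Hypotheses (ha : a != 0) (hb : b != 0).

Lemma core_actionV : T *m block_mx 0 (a^-1)%:M (b^-1)%:M 0 = 1%:M.
Proof.
rewrite /core_action !blockE !zeroE !mul_scalar_mx !scale_scalar_mx.
by rewrite !mulfV // -scalar_mx_block.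
Qed.

Lemma core_action_unit : T \in unitmx.
Proof. by case/mulmx1_unit: core_actionV. Qed.

Lemma core_basis_free : row_free U^T.
Proof.
apply/row_freeP; exists (col_mx (block_mx (a^-1)%:M 0 0 0)
                                (block_mx 0 (b^-1)%:M 0 0)).
rewrite /core_basis tr_col_mx !tr_block_mx !blockE !trmx0 !zeroE !tr_scalar_mx.
by rewrite !mul_scalar_mx !scale_scalar_mx !mulfV // -scalar_mx_block.
Qed.

Lemma core_gram_unit : U ^t conj *m U \in unitmx <-> r != 0 /\ h != 0.
Proof.
rewrite core_gram block_diag_mx_unit !unitmx11 !mxE !mulr1n.
by split=> [/andP | ?]; last apply/andP.
Qed.

Lemma double_star_cEP : cEP_invertible conj M <-> r != 0 /\ h != 0.
Proof.
apply: iff_trans core_gram_unit.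
exact: (cEP_invertible_core conj mul_star_core_basis core_action_unit
          double_star_sqr core_basis_free).
Qed.

Lemma left_inverse_cV k (v : 'cV[F]_k) : v != 0 -> exists g, g *m v = 1%:M.
Proof.
move=> v0; have /row_freeP[g hg] : row_free v^T.
  by rewrite /row_free rank_rV trmx_eq0 v0.
by exists g^T; rewrite -[v]trmxK -trmx_mul hg trmx1.
Qed.

(** The rows of [M] in the second block are the multiples of [e1^T] by the entries
    of [y], those in the fourth block the multiples of [e3^T] by the entries of [w],
    and some entry of each vector is nonzero. *)
Lemma centres_row_space : y != 0 -> w != 0 -> (V ^t conj <= M)%MS.
Proof.
case/left_inverse_cV=> y' hy' /left_inverse_cV[w' hw'].
apply/submxP; exists (row_mx (block_mx 0 0 0 y') (block_mx 0 w' 0 0)).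
rewrite /centres /double_star_mx tr_col_mx map_row_mx !tr_block_mx !map_block_mx.
by rewrite !blockE !trmx0 !map_mx0 !zeroE !star1 hy' hw'.
Qed.

Lemma double_star_GDCE : r != 0 -> h != 0 ->
  V *m invmx T *m invmx (U ^t conj *m U) *m (U ^t conj *m M) =
  double_star_GDC conj x z a b r h.
Proof.
move=> r0 h0; rewrite core_gram (invmx_eq core_actionV).
have -> : invmx (block_mx r%:M 0 0 h%:M : 'M[F]_(1 + 1)) =
    block_mx (r^-1)%:M 0 0 (h^-1)%:M.
  apply: invmx_eq; rewrite !blockE !zeroE !mul_scalar_mx !scale_scalar_mx.
  by rewrite !mulfV // -scalar_mx_block.
have -> : U ^t conj *m M = row_mx (block_mx 0 (conj a *: x^T) h%:M 0)
                                  (block_mx r%:M 0 0 (conj b *: z^T)).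
  rewrite /core_basis /double_star_mx tr_col_mx map_row_mx !tr_block_mx !map_block_mx.
  rewrite !trmx0 !map_mx0 !blockE !zeroE !tr_scalar_mx !map_scalar_mx /=.
  rewrite !mul_scalar_mx !scale_scalar_mx.
  rewrite [in LHS](mx11_scalar (w ^t conj *m w)).
  rewrite [in LHS](mx11_scalar (y ^t conj *m y)).
  rewrite -!raddfD /= [_ + conj b * b]addrC.
  by rewrite (mulrC (conj a)) (mulrC (conj b)).
have -> : V *m block_mx 0 (a^-1)%:M (b^-1)%:M 0 *m block_mx (r^-1)%:M 0 0 (h^-1)%:M
  = col_mx (block_mx ((b * r)^-1)%:M 0 0 0) (block_mx 0 ((a * h)^-1)%:M 0 0).
  rewrite /centres mul_col_mx !mulmx_block mul_col_mx !mulmx_block !zeroE !mul1mx.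
  by rewrite -!scalar_mxM -!invfM.
rewrite /double_star_GDC mul_col_row !mulmx_block !zeroE !mul_scalar_mx.
by rewrite !scale_scalar_mx !scalerA !invfM !mulfVK // ![_ * conj _]mulrC.
Qed.

Lemma double_star_GDC_unique : y != 0 -> w != 0 -> r != 0 -> h != 0 ->
  MP_invertible conj M ->
  unique (is_GDC conj M) (double_star_GDC conj x z a b r h).
Proof.
move=> y0 w0 r0 h0 mM; rewrite -double_star_GDCE //.
apply: (GDC_core mul_star_core_basis core_action_unit double_star_sqr _
          mul_star_centres (centres_row_space y0 w0) mM).
by apply/core_gram_unit.
Qed.

End DoubleStar.

Theorem lemma6p1 (F : fieldType) (conj : involutive_rmorphism F) (m n : nat)
    (hm : (1 <= m)%N) (hn : (1 <= n)%N)
    (x y : 'cV[F]_m) (z w : 'cV[F]_n) (a b : F)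
    (hx : forall i, x i 0 != 0) (hy : forall i, y i 0 != 0)
    (hz : forall i, z i 0 != 0) (hw : forall i, w i 0 != 0)
    (ha : a != 0) (hb : b != 0)
    (hxy : x^T *m y = 0) (hzw : z^T *m w = 0) :
  let M := double_star_mx x y z w a b in
  let s := (x ^t conj *m x) 0 0 in
  let u := (y ^t conj *m y) 0 0 in
  let t := (z ^t conj *m z) 0 0 in
  let v := (w ^t conj *m w) 0 0 in
  let r := a * conj a + (w ^t conj *m w) 0 0 in
  let h := b * conj b + (y ^t conj *m y) 0 0 in
  ((MP_invertible conj M /\ cEP_invertible conj M) <->
   [/\ [/\ s != 0, u != 0 & t != 0] & [/\ v != 0, r != 0 & h != 0]]) /\
  (MP_invertible conj M -> cEP_invertible conj M ->
   unique (is_GDC conj M) (double_star_GDC conj x z a b r h)).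
Proof.
move=> M s u t v r h.
have neq0 k (c : 'cV[F]_k) : (0 < k)%N -> (forall i, c i 0 != 0) -> c != 0.
  case: k c => // k c _ hc; apply/eqP=> c0.
  by have := hc ord0; rewrite c0 mxE eqxx.
have [x0 y0] := (neq0 _ _ hm hx, neq0 _ _ hm hy).
have [z0 w0] := (neq0 _ _ hn hz, neq0 _ _ hn hw).
have [mp1 mp2] := double_star_MP conj a b x0 y0 z0 w0.
have [ce1 ce2] := double_star_cEP conj hxy hzw ha hb.
split; first split.
- by case=> /mp1[[? ?] [? ?]] /ce1[].
- by case=> [[? ? ?] [? ? ?]]; split; [apply: mp2 | apply: ce2].
by move=> mM /ce1[r0 h0]; apply: double_star_GDC_unique.
Qed.
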